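(* For every single-qubit state $\ket{\psi}$ we have $\chi(\psi^{\otimes m}) = O\left((m+1)2^{m/2}\right)$ as $m\to\infty$.
   Context: An $n$-qubit stabilizer state is a state of the form $C\ket{0^n}$ with $C$ an $n$-qubit Clifford unitary. The stabilizer rank $\chi(\psi)$ of an $n$-qubit state $\ket{\psi}$ is the minimum $k$ such that $\ket{\psi}=\sum_{i=1}^k c_i\ket{\Phi_i}$ with $c_i\in\mathbb{C}$ and $\ket{\Phi_i}$ stabilizer states. $\psi^{\otimes m}$ denotes $\ket{\psi}^{\otimes m}$. *)

(* Defs.v *)
From mathcomp Require Import all_boot all_algebra spectral.
From mathcomp Require Import complex reals boolp.
Set Implicit Arguments.
Unset Strict Implicit.
Unset Printing Implicit Defensive.
Import GRing.Theory Num.Theory.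
Local Open Scope sesquilinear_scope.
Local Open Scope ring_scope.

Section Qubits.
Variable R : realType.
Local Notation C := R[i].

(* Computational basis: the index i < 2^n of a vector in C^(2^n) encodes the
   bit string (bit 0 i, ..., bit (n-1) i), i = sum_k bit k i * 2^k;
   qubit k corresponds to bit k. *)
Definition bit (k i : nat) : 'I_2 := inord (odd (i %/ 2 ^ k)).

(* Single-qubit Pauli matrices: 0 = I, 1 = X, 2 = Y, 3 = Z. *)
Definition pauli (a : 'I_4) : 'M[C]_2 :=
  \matrix_(r < 2, s < 2)
    match nat_of_ord a with
    | 0 => if r == s then 1 else 0
    | 1 => if r == s then 0 else 1
    | 2 => if r == s then 0 else (if (r : nat) == 0%N then - 'i else 'i)
    | _ => if r == s then (if (r : nat) == 0%N then 1 else -1) else 0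
    end.

Definition pauli_string (n : nat) (p : 'I_n -> 'I_4) : 'M[C]_(2 ^ n) :=
  \matrix_(i, j) \prod_(k < n) pauli (p k) (bit k i) (bit k j).

Definition clifford (n : nat) (U : 'M[C]_(2 ^ n)) : Prop :=
  U \is unitarymx /\
  forall p : 'I_n -> 'I_4, exists (q : 'I_n -> 'I_4) (c : C),
    c \in [:: 1; -1; 'i; - 'i] /\ U *m pauli_string p *m U ^t* = c *: pauli_string q.

Definition ket0 (n : nat) : 'cV[C]_(2 ^ n) := \col_i ((i : nat) == 0%N)%:R.

Definition stab_state (n : nat) (v : 'cV[C]_(2 ^ n)) : Prop :=
  exists U : 'M[C]_(2 ^ n), clifford U /\ v = U *m ket0 n.

Definition stab_decomp (n : nat) (v : 'cV[C]_(2 ^ n)) (k : nat) : Prop :=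
  exists (c : 'I_k -> C) (Phi : 'I_k -> 'cV[C]_(2 ^ n)),
    (forall j, stab_state (Phi j)) /\ v = \sum_(j < k) c j *: Phi j.

(* Stabilizer rank: least k admitting such a decomposition
   (such k always exists; the fallback 0 is never used). *)
Definition stab_rank (n : nat) (v : 'cV[C]_(2 ^ n)) : nat :=
  match pselect (exists k, `[< stab_decomp v k >]) with
  | left H => ex_minn H
  | right _ => 0%N
  end.

Definition tpow (m : nat) (psi : 'cV[C]_2) : 'cV[C]_(2 ^ m) :=
  \col_i \prod_(k < m) psi (bit k i) 0.

End Qubits.

(* Main.v *)
(* Every single-qubit psi satisfies chi(psi^(x)6) <= 8 = 2^(6/2); taking tensor
   products of blocks of six qubits then gives chi(psi^(x)m) <= 32 * 2^(m/2).

   Let D_w be the sum of the basis states of weight w on six qubits, so that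
   psi^(x)6 is a combination of D_0, ..., D_6.  Let E and O be the sums over the
   strings of even and odd weight.  The eight stabilizer states are |000000>,
   |111111>, E, O, the images E' and O' of E and O under |x> -> i^|x| |x>, and
     T = sum over odd x of (-1)^(x0 x1 + x1 x2 + x0 x2) |x>
   together with its image T' under the same map.  The first six span
   D_0, D_2, D_3, D_4, D_6 and D_1 + D_5.  The sign in T is +1 on the strings of
   weight 1 and -1 on those of weight 5 (a triangle has an odd number of edges
   and only even degrees), and T - iT' cancels in weight 3, so that
   T - iT' = 2 (D_1 - D_5).

   All stabilizer states are produced from |0...0> by the Clifford
   rotations (1 + iP) / sqrt 2 (up to a global phase) for Pauli strings P. *)
Require Import Defs.
From mathcomp Require Import all_boot all_order all_algebra spectral.
From mathcomp Require Import complex reals boolp.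
From mathcomp Require Import ring zify.
Import Order.TTheory GRing.Theory Num.Theory.
Local Open Scope sesquilinear_scope.
Local Open Scope ring_scope.

(** * Binary expansions of basis indices *)

Section Bits.

Lemma bit_inj_nat (k i j : nat) :
  bit k i = bit k j -> odd (i %/ 2 ^ k) = odd (j %/ 2 ^ k).
Proof.
move=> /(congr1 val); rewrite /= !inordK; try by case: odd.
by case: odd; case: odd.
Qed.

(** Induction strips the lowest bit: the hypothesis at 0 compares remainders mod 2, and at [k.+1] it
    is the hypothesis at [k] for the halves. *)
Lemma binary_expansion_inj (n i j : nat) : (i < 2 ^ n)%N -> (j < 2 ^ n)%N ->
  (forall k, (k < n)%N -> odd (i %/ 2 ^ k) = odd (j %/ 2 ^ k)) -> i = j.
Proof.
elim: n i j => [|n IHn] i j; first by rewrite expn0; case: i => //; case: j.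
rewrite expnS => ilt jlt eqb.
have half k : (k < 2 * 2 ^ n)%N -> (k %/ 2 < 2 ^ n)%N.
  by rewrite ltn_divLR // mulnC.
rewrite (divn_eq i 2) (divn_eq j 2) !modn2.
have := eqb 0%N isT; rewrite expn0 !divn1 => ->.
rewrite (IHn (i %/ 2)%N (j %/ 2)%N) ?half // => k kn.
by have := eqb k.+1 kn; rewrite expnS !divnMA.
Qed.

Definition bits {n} (i : 'I_(2 ^ n)) : {ffun 'I_n -> 'I_2} :=
  [ffun k : 'I_n => bit k i].

Lemma bits_inj n : injective (@bits n).
Proof.
move=> i j /ffunP eqb; apply/val_inj.
apply: (@binary_expansion_inj n i j (ltn_ord i) (ltn_ord j)) => k kn.
by have := eqb (Ordinal kn); rewrite !ffunE => /bit_inj_nat.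
Qed.

Lemma bits_bij n : bijective (@bits n).
Proof. by apply: inj_card_bij (@bits_inj n) _; rewrite card_ffun !card_ord. Qed.

Lemma lo_subproof (m n : nat) (i : 'I_(2 ^ (m + n))) : (i %% 2 ^ m < 2 ^ m)%N.
Proof. by rewrite ltn_mod expn_gt0. Qed.

Lemma hi_subproof (m n : nat) (i : 'I_(2 ^ (m + n))) : (i %/ 2 ^ m < 2 ^ n)%N.
Proof. by rewrite ltn_divLR ?expn_gt0 // mulnC -expnD ltn_ord. Qed.

(** Bit k has weight 2^k, so [lo] indexes the first m qubits of a tensor product and [hi] the last
    n. *)
Definition lo {m n} (i : 'I_(2 ^ (m + n))) : 'I_(2 ^ m) := Ordinal (@lo_subproof m n i).
Definition hi {m n} (i : 'I_(2 ^ (m + n))) : 'I_(2 ^ n) := Ordinal (@hi_subproof m n i).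

Lemma lohi_inj m n : injective (fun i : 'I_(2 ^ (m + n)) => (lo i, hi i)).
Proof.
move=> i j [eql eqh]; apply/val_inj => /=.
by rewrite (divn_eq i (2 ^ m)) eql eqh -divn_eq.
Qed.

Lemma lohi_bij m n : bijective (fun i : 'I_(2 ^ (m + n)) => (lo i, hi i)).
Proof.
by apply: inj_card_bij (@lohi_inj m n) _; rewrite card_prod !card_ord expnD.
Qed.

Lemma eq_lohi m n (i j : 'I_(2 ^ (m + n))) :
  (i == j) = (lo i == lo j) && (hi i == hi j).
Proof.
apply/eqP/andP => [-> //|[/eqP el /eqP eh]].
by apply: (@lohi_inj m n); rewrite /= el eh.
Qed.

Lemma bit_lo m n (i : 'I_(2 ^ (m + n))) (k : 'I_m) : bit k (lo i) = bit k i.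
Proof.
rewrite /bit /= [in RHS](divn_eq i (2 ^ m)).
(* After division by 2^k, the multiple of 2^m in i still has a factor 2, so it does not affect the
   parity. *)
have -> : (2 ^ m = 2 * 2 ^ (m - k.+1) * 2 ^ k)%N.
  by rewrite -expnS -expnD; congr (2 ^ _)%N; have := ltn_ord k; lia.
rewrite [in RHS]mulnA divnMDl ?expn_gt0 // oddD [in RHS](mulnCA _ 2) oddM /=.
by [].
Qed.

Lemma bit_hi m n (i : 'I_(2 ^ (m + n))) (k : 'I_n) :
  bit k (hi i) = bit (m + k) i.
Proof. by rewrite /bit /= -divnMA -(expnD 2 m). Qed.

End Bits.

(** * Tensor products of 2 x 2 matrices *)

Section TensorMatrix.
Variable R : realType.
Local Notation C := R[i].

Definition tensor_mx n (A : 'I_n -> 'M[C]_2) : 'M[C]_(2 ^ n) :=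
  \matrix_(i, j) \prod_(k < n) A k (bit k i) (bit k j).

(** Distributivity: through [bits], summing over indices is summing over all choices of one bit per
    qubit. *)
Lemma sum_prod_bits n (f : 'I_n -> 'I_2 -> C) :
  \sum_(i < 2 ^ n) \prod_(k < n) f k (bit k i) = \prod_(k < n) \sum_b f k b.
Proof.
rewrite bigA_distr_bigA (reindex (@bits n)) /=; last exact/onW_bij/bits_bij.
by apply: eq_bigr => i _; apply: eq_bigr => k _; rewrite ffunE.
Qed.

Lemma tensor_mxM n (A B : 'I_n -> 'M[C]_2) :
  tensor_mx n A *m tensor_mx n B = tensor_mx n (fun k => A k *m B k).
Proof.
apply/matrixP => i j; rewrite !mxE.
under [RHS]eq_bigr => k _ do rewrite mxE.
rewrite -(sum_prod_bits n (fun k b => A k (bit k i) b * B k b (bit k j))).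
by apply: eq_bigr => l _; rewrite !mxE big_split.
Qed.

Lemma tensor_mxZ n (c : 'I_n -> C) (A : 'I_n -> 'M[C]_2) :
  tensor_mx n (fun k => c k *: A k) = (\prod_k c k) *: tensor_mx n A.
Proof.
apply/matrixP => i j; rewrite !mxE -big_split /=.
by apply: eq_bigr => k _; rewrite mxE.
Qed.

Lemma tensor_mx_adj n (A : 'I_n -> 'M[C]_2) :
  (tensor_mx n A) ^t* = tensor_mx n (fun k => (A k) ^t*).
Proof.
apply/matrixP => i j; rewrite !mxE rmorph_prod.
by apply: eq_bigr => k _; rewrite !mxE.
Qed.

Lemma tensor_mx1 n : tensor_mx n (fun=> 1%:M) = 1%:M.
Proof.
apply/matrixP => i j; rewrite !mxE; case: eqP => [->|/eqP neq].
  by rewrite big1 // => k _; rewrite mxE eqxx.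
have [k neqk] : exists k, bits i k != bits j k.
  apply/existsP; apply: contraR neq; rewrite negb_exists => /forallP eqb.
  by apply/eqP/(@bits_inj n)/ffunP => k; apply/eqP/negPn.
rewrite !ffunE in neqk.
by rewrite (bigD1 k) //= mxE (negPf neqk) mul0r.
Qed.

Lemma tensor_mx_ext n (A B : 'I_n -> 'M[C]_2) :
  A =1 B -> tensor_mx n A = tensor_mx n B.
Proof.
by move=> eqAB; apply/matrixP => i j; rewrite !mxE; apply: eq_bigr => k _; rewrite eqAB.
Qed.

End TensorMatrix.

(** * Products, adjoints and commutation of Pauli strings *)

Section PauliStrings.
Variable R : realType.
Local Notation C := R[i].
Local Notation phases := ([:: 1; -1; 'i; - 'i] : seq C).

Lemma ord4_ind (P : 'I_4 -> Prop) :
  P (inord 0) -> P (inord 1) -> P (inord 2) -> P (inord 3) -> forall a, P a.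
Proof.
move=> P0 P1 P2 P3 [[|[|[|[|//]]]] lt4].
- by rewrite (_ : Ordinal _ = inord 0) //; apply/val_inj; rewrite /= inordK.
- by rewrite (_ : Ordinal _ = inord 1) //; apply/val_inj; rewrite /= inordK.
- by rewrite (_ : Ordinal _ = inord 2) //; apply/val_inj; rewrite /= inordK.
- by rewrite (_ : Ordinal _ = inord 3) //; apply/val_inj; rewrite /= inordK.
Qed.

Lemma mul_ii : 'i * 'i = -1 :> C.
Proof. by rewrite -expr2 sqrCi. Qed.

Lemma phasesM (c d : C) : c \in phases -> d \in phases -> c * d \in phases.
Proof.
rewrite !inE => /or4P[] /eqP-> /or4P[] /eqP->;
  rewrite ?(mul1r, mulr1, mulN1r, mulrN1, mulrN, mulNr, mul_ii, opprK) ?eqxx ?orbT //.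
Qed.

Lemma phases_prod n (c : 'I_n -> C) :
  (forall k, c k \in phases) -> \prod_k c k \in phases.
Proof.
move=> cP; elim/big_ind: _ => //; last exact: phasesM.
by rewrite inE eqxx.
Qed.

Lemma pauli_adj a : (pauli R a) ^t* = pauli R a.
Proof.
apply/matrixP => i j; rewrite !mxE; move: a.
by apply: ord4_ind; rewrite inordK //; case: i => [[|[|//]]] ? ; case: j => [[|[|//]]] ?;
  rewrite /= ?(rmorphN, rmorph1, rmorph0) /= ?conjCi ?opprK.
Qed.

Lemma pauli_sqr a : pauli R a *m pauli R a = 1%:M.
Proof.
apply/matrixP => i j; rewrite !mxE !big_ord_recl big_ord0 !mxE; move: a.
by apply: ord4_ind; rewrite inordK //; case: i => [[|[|//]]] ? ; case: j => [[|[|//]]] ?;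
  rewrite /= ?(mul1r, mulr1, mulN1r, mulrN1, mulrN, mulNr, mul_ii, opprK,
    mulr0, addr0, add0r, mul0r, oppr0).
Qed.

Ltac pauli_entries :=
  apply/matrixP => -[[|[|//]]] ? -[[|[|//]]] ?;
  rewrite !mxE !big_ord_recl !big_ord0 !mxE !inordK //;
  rewrite /= ?(mul1r, mulr1, mulN1r, mulrN1, mulrN, mulNr, mul_ii, opprK,
    mulr0, addr0, add0r, mul0r, oppr0) //.

Lemma pauli_mul a b : exists (d : 'I_4) (c : C),
  c \in phases /\ pauli R a *m pauli R b = c *: pauli R d.
Proof.
have [in1 in3 in4] : [/\ (1 : C) \in phases, 'i \in phases & - 'i \in phases].
  by rewrite !inE !eqxx !orbT.
move: a b; apply: ord4_ind; apply: ord4_ind.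
- by exists (inord 0), 1; split=> //; pauli_entries.
- by exists (inord 1), 1; split=> //; pauli_entries.
- by exists (inord 2), 1; split=> //; pauli_entries.
- by exists (inord 3), 1; split=> //; pauli_entries.
- by exists (inord 1), 1; split=> //; pauli_entries.
- by exists (inord 0), 1; split=> //; pauli_entries.
- by exists (inord 3), 'i; split=> //; pauli_entries.
- by exists (inord 2), (- 'i); split=> //; pauli_entries.
- by exists (inord 2), 1; split=> //; pauli_entries.
- by exists (inord 3), (- 'i); split=> //; pauli_entries.
- by exists (inord 0), 1; split=> //; pauli_entries.
- by exists (inord 1), 'i; split=> //; pauli_entries.
- by exists (inord 3), 1; split=> //; pauli_entries.
- by exists (inord 2), 'i; split=> //; pauli_entries.
- by exists (inord 1), (- 'i); split=> //; pauli_entries.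
- by exists (inord 0), 1; split=> //; pauli_entries.
Qed.

Lemma pauli_comm a b : exists s : bool,
  pauli R a *m pauli R b = (-1) ^+ s *: (pauli R b *m pauli R a).
Proof.
move: a b; apply: ord4_ind; apply: ord4_ind;
  solve [by exists false; pauli_entries | by exists true; pauli_entries].
Qed.

Lemma pauli_stringE n (p : 'I_n -> 'I_4) :
  pauli_string R p = tensor_mx R n (fun k => pauli R (p k)).
Proof. by []. Qed.

Lemma pauli_string_adj n (p : 'I_n -> 'I_4) :
  (pauli_string R p) ^t* = pauli_string R p.
Proof.
rewrite pauli_stringE tensor_mx_adj; apply: tensor_mx_ext => k.
exact: pauli_adj.
Qed.

Lemma pauli_string_sqr n (p : 'I_n -> 'I_4) :
  pauli_string R p *m pauli_string R p = 1%:M.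
Proof.
rewrite pauli_stringE tensor_mxM -tensor_mx1; apply: tensor_mx_ext => k.
exact: pauli_sqr.
Qed.

Lemma pauli_string_mul n (p q : 'I_n -> 'I_4) :
  exists (r : 'I_n -> 'I_4) (c : C),
  c \in phases /\ pauli_string R p *m pauli_string R q = c *: pauli_string R r.
Proof.
have [r rP] := fin_all_exists (fun k => pauli_mul (p k) (q k)).
have [c cP] := fin_all_exists rP.
exists r, (\prod_k c k); split; first by apply: phases_prod => k; case: (cP k).
rewrite !pauli_stringE tensor_mxM -tensor_mxZ; apply: tensor_mx_ext => k.
by case: (cP k).
Qed.

(** The sign is the parity of the number of positions at which the two factors anticommute. *)
Lemma pauli_string_comm n (p q : 'I_n -> 'I_4) : exists s : bool,
  pauli_string R p *m pauli_string R q =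
  (-1) ^+ s *: (pauli_string R q *m pauli_string R p).
Proof.
have [s sP] := fin_all_exists (fun k => pauli_comm (p k) (q k)).
exists (odd (\sum_k s k)); rewrite !pauli_stringE !tensor_mxM.
rewrite signr_odd -prodrXr -tensor_mxZ.
exact: tensor_mx_ext.
Qed.

End PauliStrings.

(** * Rotations generated by a self-adjoint involution *)

Section InvolutionRotation.
Variables (C : numClosedFieldType) (N : nat).

(* Up to a global phase this is exp(i pi/4 P) when P is an involution. *)
Definition rotation_mx (P : 'M[C]_N) : 'M[C]_N :=
  ((1 - 'i) / 2) *: 1%:M + ((1 + 'i) / 2) *: P.

(** With a = (1 - i)/2 and b = (1 + i)/2 conjugate to each other, the product (a + bP) Q (b + aP) is
    expanded using ab = 1/2, b^2 = i/2 and a^2 = -i/2. *)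
Lemma rotation_mx_conj (P Q : 'M[C]_N) : P ^t* = P ->
  rotation_mx P *m Q *m (rotation_mx P) ^t* =
  2^-1 *: (Q + P *m Q *m P) + ('i / 2) *: (P *m Q - Q *m P).
Proof.
move=> adjP.
have i2 : 'i * 'i = -1 :> C by rewrite -expr2 sqrCi.
have aa : ((1 - 'i) / 2)^* = (1 + 'i) / 2 :> C.
  by rewrite rmorphM fmorphV rmorphB rmorph1 /= conjCi opprK rmorph_nat.
have bb : ((1 + 'i) / 2)^* = (1 - 'i) / 2 :> C by rewrite -aa conjCK.
have -> : (rotation_mx P) ^t* = ((1 + 'i) / 2) *: 1%:M + ((1 - 'i) / 2) *: P.
  rewrite /rotation_mx linearD /= map_mxD !linearZ /= !map_mxZ adjP trmx1 map_mx1 /=.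
  by rewrite aa bb.
rewrite /rotation_mx.
have ab : (1 - 'i) / 2 * ((1 + 'i) / 2) = 2^-1 :> C by field : i2.
have b2 : (1 + 'i) / 2 * ((1 + 'i) / 2) = 'i / 2 :> C by field : i2.
have a2 : (1 - 'i) / 2 * ((1 - 'i) / 2) = - ('i / 2) :> C by field : i2.
move: ab b2 a2; set a := (1 - 'i) / 2; set b := (1 + 'i) / 2 => ab b2 a2.
rewrite !(mulmxDl, mulmxDr) -!(scalemxAl, scalemxAr).
rewrite !(mul1mx, mulmx1) !scalerA [b * a]mulrC ab b2 a2.
by rewrite scalerBr scalerDr scaleNr [- _ + _]addrC addrACA.
Qed.

Lemma rotation_mx_conj_comm (P Q : 'M[C]_N) : P ^t* = P -> P *m P = 1%:M ->
  P *m Q = Q *m P -> rotation_mx P *m Q *m (rotation_mx P) ^t* = Q.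
Proof.
move=> adjP PP PQ; rewrite rotation_mx_conj // PQ -mulmxA PP mulmx1 subrr.
by rewrite scaler0 addr0 -mulr2n -scaler_nat scalerA mulVf ?scale1r // pnatr_eq0.
Qed.

Lemma rotation_mx_conj_anticomm (P Q : 'M[C]_N) : P ^t* = P -> P *m P = 1%:M ->
  P *m Q = - (Q *m P) -> rotation_mx P *m Q *m (rotation_mx P) ^t* = 'i *: (P *m Q).
Proof.
move=> adjP PP PQ; rewrite rotation_mx_conj // PQ mulNmx -mulmxA PP mulmx1 subrr.
rewrite scaler0 add0r -opprD -mulr2n -scaler_nat -!scalerN scalerA divfK //.
by rewrite pnatr_eq0.
Qed.

(** The identity commutes with P, so conjugation by the rotation fixes it. *)
Lemma rotation_mx_unitary (P : 'M[C]_N) : P ^t* = P -> P *m P = 1%:M ->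
  rotation_mx P \is unitarymx.
Proof.
move=> adjP PP; apply/unitarymxP; rewrite -[X in X *m _]mulmx1.
by apply: rotation_mx_conj_comm; rewrite ?mul1mx ?mulmx1.
Qed.

(** Up to the scalar 1 + i, the rotation acts as I + iP, a form free of denominators. *)
Lemma rotation_mxE m (P : 'M[C]_N) (v : 'M[C]_(N, m)) :
  (1 + 'i) *: (rotation_mx P *m v) = v + 'i *: (P *m v).
Proof.
have i2 : 'i * 'i = -1 :> C by rewrite -expr2 sqrCi.
rewrite mulmxDl -!scalemxAl mul1mx scalerDr !scalerA.
have -> : (1 + 'i) * ((1 - 'i) / 2) = 1 :> C by field : i2.
have -> : (1 + 'i) * ((1 + 'i) / 2) = 'i :> C by field : i2.
by rewrite scale1r.
Qed.

(** Since (I + iP)^2 = 2iP, two rotations yield P itself up to a scalar. *)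
Lemma involution_rotation2 m (P : 'M[C]_N) (v : 'M[C]_(N, m)) : P *m P = 1%:M ->
  let w := v + 'i *: (P *m v) in
  w + 'i *: (P *m w) = (2 * 'i) *: (P *m v).
Proof.
move=> PP w; rewrite /w mulmxDr -scalemxAr mulmxA PP mul1mx scalerDr scalerA.
rewrite -expr2 sqrCi scaleN1r [v + _]addrC addrACA subrr addr0.
by rewrite -mulr2n -scaler_nat scalerA.
Qed.

(** The inverse rotation is obtained from the forward one: I - iP = -i (I + iP) P. *)
Lemma involution_rotationN m (P : 'M[C]_N) (v : 'M[C]_(N, m)) : P *m P = 1%:M ->
  - 'i *: (P *m v + 'i *: (P *m (P *m v))) = v - 'i *: (P *m v).
Proof.
move=> PP; rewrite mulmxA PP mul1mx scalerDr scalerA mulNr -expr2 sqrCi opprK.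
by rewrite scale1r scaleNr addrC.
Qed.

End InvolutionRotation.

(** * Clifford unitaries and stabilizer states up to scalars *)

Section Clifford.
Variable R : realType.
Local Notation C := R[i].
Local Notation phases := ([:: 1; -1; 'i; - 'i] : seq C).

Lemma clifford1 n : clifford (1%:M : 'M[C]_(2 ^ n)).
Proof.
have adj1 : (1%:M : 'M[C]_(2 ^ n)) ^t* = 1%:M by rewrite trmx1 map_mx1.
split; first by apply/unitarymxP; rewrite adj1 mulmx1.
move=> p; exists p, 1; split; first by rewrite inE eqxx.
by rewrite adj1 mulmx1 mul1mx scale1r.
Qed.

Lemma cliffordM n (U V : 'M[C]_(2 ^ n)) :
  clifford U -> clifford V -> clifford (U *m V).
Proof.
move=> [Uu Up] [Vu Vp]; split; first exact: (mul_unitarymx Uu Vu).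
move=> p; have [q [c [cP qP]]] := Vp p; have [r [d [dP rP]]] := Up q.
exists r, (c * d); split; first exact: phasesM.
rewrite trmx_mul map_mxM !mulmxA -2!(mulmxA U) qP.
by rewrite -scalemxAr -scalemxAl rP scalerA.
Qed.

(** Conjugation fixes a string Q commuting with P and sends an anticommuting one to iPQ, again a
    string up to a phase. *)
Lemma clifford_rotation n (p : 'I_n -> 'I_4) :
  clifford (rotation_mx C (2 ^ n) (pauli_string R p)).
Proof.
have adjP := pauli_string_adj R n p; have PP := pauli_string_sqr R n p.
split; first exact: rotation_mx_unitary.
move=> q; have [[] PQ] := pauli_string_comm R n p q; last first.
  exists q, 1; split; first by rewrite inE eqxx.
  by rewrite rotation_mx_conj_comm ?scale1r // PQ scale1r.
have [r [c [cP PQr]]] := pauli_string_mul R n p q.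
exists r, ('i * c); split; first by apply: phasesM cP; rewrite !inE eqxx !orbT.
rewrite (rotation_mx_conj_anticomm _ _ _ _ adjP PP); last by rewrite PQ expr1 scaleN1r.
by rewrite PQr scalerA.
Qed.

(** An arbitrary scalar, possibly 0, spares all bookkeeping of norms and global phases;
    decomposition coefficients absorb it. *)
Definition scaled_stab n (v : 'cV[C]_(2 ^ n)) : Prop :=
  exists (c : C) (u : 'cV[C]_(2 ^ n)), stab_state u /\ v = c *: u.

Lemma scaled_stab_ket0 n : scaled_stab n (ket0 R n).
Proof.
exists 1, (ket0 R n); rewrite scale1r; split=> //.
by exists 1%:M; rewrite mul1mx; split=> //; exact: clifford1.
Qed.

Lemma scaled_stabZ n (c : C) v : scaled_stab n v -> scaled_stab n (c *: v).
Proof.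
by move=> [d [u [us ->]]]; exists (c * d), u; rewrite scalerA.
Qed.

Lemma scaled_stab_clifford n U v :
  clifford U -> scaled_stab n v -> scaled_stab n (U *m v).
Proof.
move=> UC [c [_ [[V [VC ->]] ->]]]; exists c, (U *m (V *m ket0 R n)).
split; last by rewrite -scalemxAr.
by exists (U *m V); split; [exact: cliffordM | exact: mulmxA].
Qed.

Lemma scaled_stab_rotation n (p : 'I_n -> 'I_4) v :
  scaled_stab n v -> scaled_stab n (v + 'i *: (pauli_string R p *m v)).
Proof.
rewrite -rotation_mxE => vs; apply/scaled_stabZ.
exact: scaled_stab_clifford (clifford_rotation n p) vs.
Qed.

Lemma scaled_stab_pauli n (p : 'I_n -> 'I_4) v :
  scaled_stab n v -> scaled_stab n (pauli_string R p *m v).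
Proof.
move=> /(scaled_stab_rotation n p)/(scaled_stab_rotation n p).
rewrite involution_rotation2; last exact: pauli_string_sqr.
move=> /(scaled_stabZ n (2 * 'i)^-1); rewrite scalerK //.
by rewrite mulf_neq0 ?pnatr_eq0 ?neq0Ci.
Qed.

Lemma scaled_stab_rotationN n (p : 'I_n -> 'I_4) v :
  scaled_stab n v -> scaled_stab n (v - 'i *: (pauli_string R p *m v)).
Proof.
move=> /(scaled_stab_pauli n p)/(scaled_stab_rotation n p).
move=> /(scaled_stabZ n (- 'i)).
by rewrite involution_rotationN //; exact: pauli_string_sqr.
Qed.

End Clifford.

(** * Kronecker products of Clifford unitaries and stabilizer states *)

Section Kronecker.
Variable R : realType.
Local Notation C := R[i].
Variables m n : nat.

Definition kron_mx (A : 'M[C]_(2 ^ m)) (B : 'M[C]_(2 ^ n)) : 'M[C]_(2 ^ (m + n)) :=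
  \matrix_(i, j) (A (lo i) (lo j) * B (hi i) (hi j)).

Definition kron_cv (u : 'cV[C]_(2 ^ m)) (v : 'cV[C]_(2 ^ n)) : 'cV[C]_(2 ^ (m + n)) :=
  \col_i (u (lo i) 0 * v (hi i) 0).

Lemma sum_lohi (f : 'I_(2 ^ m) -> C) (g : 'I_(2 ^ n) -> C) :
  \sum_(i < 2 ^ (m + n)) f (lo i) * g (hi i) = (\sum_i f i) * (\sum_j g j).
Proof.
rewrite big_distrlr /= pair_bigA (reindex (fun i : 'I_(2 ^ (m + n)) => (lo i, hi i))) //=.
exact/onW_bij/lohi_bij.
Qed.

Lemma kron_mxM A B A' B' :
  kron_mx A B *m kron_mx A' B' = kron_mx (A *m A') (B *m B').
Proof.
apply/matrixP => i j; rewrite !mxE -sum_lohi; apply: eq_bigr => k _.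
by rewrite !mxE mulrACA.
Qed.

Lemma kron_mx_cv A B u v : kron_mx A B *m kron_cv u v = kron_cv (A *m u) (B *m v).
Proof.
apply/matrixP => i j; rewrite !mxE -sum_lohi; apply: eq_bigr => k _.
by rewrite !mxE mulrACA.
Qed.

Lemma kron_mx_adj A B : (kron_mx A B) ^t* = kron_mx (A ^t*) (B ^t*).
Proof. by apply/matrixP => i j; rewrite !mxE rmorphM. Qed.

Lemma kron_mx1 : kron_mx 1%:M 1%:M = 1%:M.
Proof. by apply/matrixP => i j; rewrite !mxE eq_lohi -natrM mulnb. Qed.

Lemma kron_mxZ c d A B : kron_mx (c *: A) (d *: B) = (c * d) *: kron_mx A B.
Proof. by apply/matrixP => i j; rewrite !mxE mulrACA. Qed.

Lemma kron_cvZ c d u v : kron_cv (c *: u) (d *: v) = (c * d) *: kron_cv u v.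
Proof. by apply/matrixP => i j; rewrite !mxE mulrACA. Qed.

(** Two bit arguments let one splitting serve both matrices and, with j = i and the second bit
    ignored, product vectors. *)
Lemma prod_bits_lohi (f : 'I_(m + n) -> 'I_2 -> 'I_2 -> C) (i j : 'I_(2 ^ (m + n))) :
  \prod_k f k (bit k i) (bit k j) =
  (\prod_(k < m) f (lshift n k) (bit k (lo i)) (bit k (lo j))) *
  (\prod_(k < n) f (rshift m k) (bit k (hi i)) (bit k (hi j))).
Proof.
rewrite big_split_ord /=; congr (_ * _); apply: eq_bigr => k _.
  by rewrite !bit_lo.
by rewrite !bit_hi.
Qed.

Lemma pauli_string_kron (p : 'I_(m + n) -> 'I_4) :
  pauli_string R p = kron_mx (pauli_string R (fun k => p (lshift n k)))
                             (pauli_string R (fun k => p (rshift m k))).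
Proof.
apply/matrixP => i j; rewrite !mxE.
exact: (prod_bits_lohi (fun k => pauli R (p k))).
Qed.

Lemma ket0_kron : ket0 R (m + n) = kron_cv (ket0 R m) (ket0 R n).
Proof.
apply/matrixP => i j; rewrite !mxE -natrM mulnb; congr (_%:R); congr nat_of_bool.
apply/eqP/andP => /= [->|[/eqP i0 /eqP j0]]; first by rewrite mod0n div0n.
by rewrite (divn_eq i (2 ^ m)) i0 j0.
Qed.

Lemma tpow_kron psi : tpow (m + n) psi = kron_cv (tpow m psi) (tpow n psi).
Proof.
apply/matrixP => i j; rewrite !mxE.
exact: (prod_bits_lohi (fun _ b _ => psi b 0) i i).
Qed.

Lemma clifford_kron U V : clifford U -> clifford V -> clifford (kron_mx U V).
Proof.
move=> [Uu Up] [Vu Vp]; split.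
  apply/unitarymxP; rewrite kron_mx_adj kron_mxM.
  by rewrite (unitarymxP Uu) (unitarymxP Vu) kron_mx1.
move=> p; rewrite pauli_string_kron kron_mx_adj !kron_mxM.
have [q [c [cP ->]]] := Up (fun k => p (lshift n k)).
have [r [d [dP ->]]] := Vp (fun k => p (rshift m k)).
(* The images on the two blocks of qubits are concatenated and their phases multiplied. *)
exists (fun k => match split k with inl a => q a | inr b => r b end), (c * d).
split; first exact: phasesM.
rewrite kron_mxZ pauli_string_kron; congr (_ *: kron_mx _ _).
  by apply/matrixP => i j; rewrite !mxE; apply: eq_bigr => k _; rewrite (unsplitK (inl k)).
by apply/matrixP => i j; rewrite !mxE; apply: eq_bigr => k _; rewrite (unsplitK (inr k)).
Qed.

Lemma stab_state_kron u v : stab_state u -> stab_state v -> stab_state (kron_cv u v).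
Proof.
move=> [U [UC ->]] [V [VC ->]]; exists (kron_mx U V).
by rewrite ket0_kron kron_mx_cv; split=> //; exact: clifford_kron.
Qed.

Lemma scaled_stab_kron u v :
  scaled_stab R m u -> scaled_stab R n v -> scaled_stab R (m + n) (kron_cv u v).
Proof.
move=> [c [u' [u's ->]]] [d [v' [v's ->]]].
exists (c * d), (kron_cv u' v'); rewrite kron_cvZ; split=> //.
exact: stab_state_kron.
Qed.

End Kronecker.

(** * Decompositions into stabilizer states and their products *)

Section StabilizerSums.
Variable R : realType.
Local Notation C := R[i].

(** Lists with absorbed coefficients make the Kronecker product of two decompositions the list of
    all pairs. *)
Definition stab_sum n (v : 'cV[C]_(2 ^ n)) (k : nat) : Prop :=
  exists s : seq 'cV[C]_(2 ^ n),
  [/\ size s = k, forall w, w \in s -> scaled_stab R n w & v = \sum_(w <- s) w].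

Lemma stab_sum_decomp n v k : stab_sum n v k -> stab_decomp v k.
Proof.
move=> [s [<- sP ->]].
have [c cP] := fin_all_exists (fun j : 'I_(size s) => sP _ (mem_nth 0 (ltn_ord j))).
have [u uP] := fin_all_exists cP.
exists c, u; split=> [j|]; first by case: (uP j).
by rewrite (big_nth 0) big_mkord; apply: eq_bigr => j _; case: (uP j).
Qed.

Lemma stab_sum_kron m n u v k l : stab_sum m u k -> stab_sum n v l ->
  stab_sum (m + n) (kron_cv R m n u v) (k * l).
Proof.
move=> [s [<- sP ->]] [t [<- tP ->]].
exists [seq kron_cv R m n a b | a <- s, b <- t]; split; first exact: size_allpairs.
  by move=> _ /allpairsP[[a b] /= [/sP aP /tP bP ->]]; exact: scaled_stab_kron.
rewrite big_allpairs_dep; apply/matrixP => i j; rewrite mxE !summxE mulr_suml.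
apply: eq_bigr => a _; rewrite mulr_sumr summxE.
by apply: eq_bigr => b _; rewrite mxE.
Qed.

Lemma stab_rank_le n v k : stab_sum n v k -> (stab_rank v <= k)%N.
Proof.
(* In the fallback branch the rank is 0 and the bound is immediate. *)
move=> /stab_sum_decomp vk; rewrite /stab_rank; case: pselect => // ex.
by case: ex_minnP => r _; apply; apply/asboolP.
Qed.

End StabilizerSums.

(** * The eight-term identity for six-qubit amplitudes *)

Section SixQubitIdentity.
Variable C : numClosedFieldType.
Implicit Type b : nat -> bool.

Definition parity n (T : pred nat) b : bool := \big[addb/false]_(0 <= k < n | T k) b k.
Definition phase n (T : pred nat) b : C := if parity n T b then 'i else 1.
Definition basis0 b : C := \prod_(0 <= k < 6) (~~ b k)%:R.
Definition basis1 b : C := \prod_(0 <= k < 6) (b k)%:R.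
Definition even_sum b : C := (~~ parity 6 predT b)%:R.
Definition odd_sum b : C := (parity 6 predT b)%:R.
(* i^(b 0 + ... + b (n-1)) *)
Definition i_pow_weight n b : C := \prod_(0 <= k < n) phase 6 (pred1 k) b.
(* For w = b 0 + b 1 + b 2 the first two factors are (-i)^(w mod 2) i^w =
   (-1)^(w (w - 1) / 2) = (-1)^(b 0 b 1 + b 1 b 2 + b 0 b 2). *)
Definition triangle b : C := phase 6 (ltn^~ 3) b ^+ 3 * i_pow_weight 3 b * odd_sum b.

Lemma sign_parity n T b :
  (-1) ^+ parity n T b = \prod_(k < n) (if T k then (-1) ^+ b k else 1) :> C.
Proof.
rewrite /parity big_mkcond big_mkord; elim/big_rec2: _ => // k c z _ <-.
by case: (T k); rewrite ?signr_addb ?mul1r.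
Qed.

(** Here [d w] is the amplitude at weight w. The two even terms give d 4 at weights 0, 4 and d 2 at
    weights 2, 6; the basis terms correct weights 0 and 6. The two odd terms give d 3 at weight 3
    and the mean of d 1 and d 5 at weights 1 and 5. The triangle terms add half of d 1 - d 5 at
    weight 1, subtract it at weight 5 and cancel at weight 3. *)
Lemma six_qubit_identity (x y : C) b :
  let d w := x ^+ (6 - w) * y ^+ w in
  \prod_(0 <= k < 6) (if b k then y else x) =
  (d 0 - d 4) * basis0 b + (d 6 - d 2) * basis1 b +
  (d 4 + d 2) / 2 * even_sum b +
  (d 4 - d 2) / 2 * (i_pow_weight 6 b * even_sum b) +
  (d 3 + (d 1 + d 5) / 2) / 2 * odd_sum b +
  'i * (d 3 - (d 1 + d 5) / 2) / 2 * (i_pow_weight 6 b * odd_sum b) +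
  (d 1 - d 5) / 4 * triangle b -
  'i * (d 1 - d 5) / 4 * (i_pow_weight 6 b * triangle b).
Proof.
move=> d; rewrite /d /basis0 /basis1 /triangle /even_sum /odd_sum /i_pow_weight /phase /parity.
rewrite unlock /=.
have i2 : 'i * 'i = -1 :> C by rewrite -expr2 sqrCi.
(* Each of the 64 bit strings leaves a rational identity in x, y and i, settled modulo i^2 = -1. *)
by case: (b 0); case: (b 1); case: (b 2); case: (b 3); case: (b 4); case: (b 5);
   rewrite /= ?expr0 ?mulr1; field : i2.
Qed.
End SixQubitIdentity.

(** * Construction of the eight stabilizer vectors, then of decompositions for all tensor powers *)

Section StabilizerVectors.
Variable R : realType.
Local Notation C := R[i].

Definition bit_fun (i k : nat) : bool := odd (i %/ 2 ^ k).
(** Amplitudes are functions of a Boolean string, the form in which [six_qubit_identity] is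
    stated. *)
Definition vec n (F : (nat -> bool) -> C) : 'cV[C]_(2 ^ n) := \col_i F (bit_fun i).

Lemma bitE k i : bit k i = inord (bit_fun i k).
Proof. by []. Qed.

Definition z_string n (T : pred nat) (k : 'I_n) : 'I_4 := if T k then inord 3 else inord 0.

Lemma z_stringE n T (F : (nat -> bool) -> C) :
  pauli_string R (z_string n T) *m vec n F =
  vec n (fun b => (-1) ^+ parity n T b * F b).
Proof.
have entry i j : pauli_string R (z_string n T) i j =
    (1%:M : 'M[C]_(2 ^ n)) i j * (-1) ^+ parity n T (bit_fun i).
  rewrite -tensor_mx1 !mxE sign_parity.
  rewrite -big_split /=; apply: eq_bigr => k _; rewrite !mxE /z_string.
  have lt2 : (odd (i %/ 2 ^ k) < 2)%N by case: odd.
  case: (T k); rewrite /bit !inordK //=; last by rewrite mulr1; case: eqP.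
  case: eqP => _; last by rewrite mul0r.
  by rewrite mul1r /bit_fun; case: odd.
apply/matrixP => i j; rewrite !mxE (bigD1 i) //= big1 ?addr0 => [|l neq].
  by rewrite entry !mxE eqxx mul1r.
by rewrite entry mxE eq_sym (negPf neq) !mul0r.
Qed.

(** For the Z string Z_T supported on T, (I - i Z_T)/(1 - i) has eigenvalue 1 where Z_T is 1, and (1
    + i)/(1 - i) = i where Z_T is -1. *)
Lemma scaled_stab_phase n T (F : (nat -> bool) -> C) :
  scaled_stab R n (vec n F) -> scaled_stab R n (vec n (fun b => phase C n T b * F b)).
Proof.
move=> /(scaled_stab_rotationN R n (z_string n T))/(scaled_stabZ R n (1 - 'i)^-1).
rewrite z_stringE; congr scaled_stab; apply/matrixP => i j; rewrite !mxE.
have nz : (1 - 'i : C) != 0.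
  rewrite subr_eq0; apply/eqP => /(congr1 (fun z => z ^+ 2)).
  rewrite expr1n sqrCi => /eqP; rewrite eq_sym -subr_eq0 -opprD oppr_eq0 -mulr2n.
  by rewrite pnatr_eq0.
apply: (mulfI nz); rewrite mulVKf // /phase.
have i2 := mul_ii R.
by case: parity; rewrite ?expr0 ?expr1; ring : i2.
Qed.

(** The factor is built one qubit at a time, by single-qubit phase gates. *)
Lemma scaled_stab_i_pow_weight n (F : (nat -> bool) -> C) :
  scaled_stab R 6 (vec 6 F) ->
  scaled_stab R 6 (vec 6 (fun b => i_pow_weight C n b * F b)).
Proof.
move=> Fs; elim: n => [|n IHn].
  move: Fs; congr scaled_stab; apply/matrixP => i j.
  by rewrite !mxE /i_pow_weight big_geq // mul1r.
have := scaled_stab_phase 6 (pred1 n) _ IHn; congr scaled_stab.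
apply/matrixP => i j; rewrite !mxE /i_pow_weight big_nat_recr //=.
by rewrite mulrA [phase _ _ _ _ * _]mulrC.
Qed.

Lemma pauli_string_tpow n (p : 'I_n -> 'I_4) (psi : 'cV[C]_2) i :
  (pauli_string R p *m tpow n psi) i 0 = \prod_(k < n) (pauli R (p k) *m psi) (bit k i) 0.
Proof.
rewrite mxE; under [RHS]eq_bigr => k _ do rewrite mxE.
rewrite -(sum_prod_bits R n (fun k b => pauli R (p k) (bit k i) b * psi b 0)).
by apply: eq_bigr => l _; rewrite !mxE -big_split.
Qed.

Definition ket (x y : C) : 'cV[C]_2 := \col_r (if r == 0 then x else y).

Lemma pauliX_ket x y : pauli R (inord 1) *m ket x y = ket y x.
Proof.
apply/matrixP => -[[|[|//]]] ? j; rewrite !mxE !big_ord_recl big_ord0 !mxE inordK //=.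
  by rewrite mul0r mul1r add0r addr0.
by rewrite mul0r mul1r addr0 addr0.
Qed.

Lemma pauliY_ket x y : pauli R (inord 2) *m ket x y = ket (- 'i * y) ('i * x).
Proof.
apply/matrixP => -[[|[|//]]] ? j; rewrite !mxE !big_ord_recl big_ord0 !mxE inordK //=.
  by rewrite mul0r add0r addr0.
by rewrite mul0r addr0 addr0.
Qed.

Lemma pauliZ_ket x y : pauli R (inord 3) *m ket x y = ket x (- y).
Proof.
apply/matrixP => -[[|[|//]]] ? j; rewrite !mxE !big_ord_recl big_ord0 !mxE inordK //=.
  by rewrite mul0r mul1r addr0 addr0.
by rewrite mul0r mulN1r addr0 add0r.
Qed.

Lemma tpow_ket n x y :
  tpow n (ket x y) = vec n (fun b => \prod_(0 <= k < n) (if b k then y else x)).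
Proof.
apply/matrixP => i j; rewrite !mxE big_mkord; apply: eq_bigr => k _.
rewrite mxE bitE -val_eqE /=; case: bit_fun; rewrite inordK //.
Qed.

Lemma scaled_stab_tpow n psi :
  scaled_stab R 1 (tpow 1 psi) -> scaled_stab R n (tpow n psi).
Proof.
move=> psi1; elim: n => [|n IHn]; last first.
  by rewrite -add1n tpow_kron; exact: scaled_stab_kron.
have := scaled_stab_ket0 R 0; congr scaled_stab.
by apply/matrixP => i j; rewrite !mxE big_ord0; case: i => -[].
Qed.

Lemma pauli_tpow1 a psi :
  pauli_string R (fun _ : 'I_1 => a) *m tpow 1 psi = tpow 1 (pauli R a *m psi).
Proof.
by apply/matrixP => i j; rewrite ord1 pauli_string_tpow mxE.
Qed.

Lemma scaled_stab_ket_0 n : scaled_stab R n (tpow n (ket 1 0)).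
Proof.
apply: scaled_stab_tpow; have := scaled_stab_ket0 R 1; congr scaled_stab.
apply/matrixP => i j; rewrite !mxE big_ord1 mxE /bit divn1.
by case: i => -[|[|//]] ? /=; rewrite -val_eqE /= inordK.
Qed.

Lemma scaled_stab_ket_1 n : scaled_stab R n (tpow n (ket 0 1)).
Proof.
apply: scaled_stab_tpow; rewrite -pauliX_ket -pauli_tpow1.
exact/scaled_stab_pauli/scaled_stab_ket_0.
Qed.

Lemma scaled_stab_plus n : scaled_stab R n (tpow n (ket 1 1)).
Proof.
apply: scaled_stab_tpow.
(* As Y|0> = i|1>, the vector |0> - iY|0> equals |0> + |1>. *)
have := scaled_stab_rotationN R 1 (fun=> inord 2) _ (scaled_stab_ket_0 1).
rewrite pauli_tpow1 pauliY_ket; congr scaled_stab.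
apply/matrixP => i j; rewrite !mxE !big_ord1 !mxE; have i2 := mul_ii R.
by case: eqP => _; ring : i2.
Qed.

(* P = Y Z ... Z sends |+...+> to -i |-...->, hence |+...+> + iP |+...+> and
   |+...+> - iP |+...+> are twice the even and the odd sum. *)
Definition yz_string (k : 'I_6) : 'I_4 := if k == ord0 then inord 2 else inord 3.

Lemma yz_string_plus : 'i *: (pauli_string R yz_string *m tpow 6 (ket 1 1)) =
  vec 6 (fun b => (-1) ^+ parity 6 predT b).
Proof.
apply/matrixP => i j; rewrite [j]ord1 mxE pauli_string_tpow.
rewrite big_ord_recl {1}/yz_string eqxx pauliY_ket.
rewrite [RHS]mxE sign_parity.
(* Qubit 0 absorbs the scalar i: iY sends (1, 1) to (1, -1), as Z does on each other qubit. *)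
rewrite [RHS]big_ord_recl mulrA; congr (_ * _).
  rewrite mxE bitE /= -val_eqE /=; have i2 := mul_ii R.
  by case: bit_fun; rewrite inordK //=; ring : i2.
apply: eq_bigr => k _; rewrite /yz_string /= pauliZ_ket mxE bitE -val_eqE /=.
by case: bit_fun; rewrite inordK.
Qed.

Lemma scaled_stab_even : scaled_stab R 6 (vec 6 (even_sum C)).
Proof.
have := scaled_stab_rotation R 6 yz_string _ (scaled_stab_plus 6).
move=> /(scaled_stabZ R 6 2^-1); rewrite yz_string_plus tpow_ket; congr scaled_stab.
apply/matrixP => i j; rewrite !mxE big1_seq; last by move=> k _; case: ifP.
by rewrite /even_sum; case: parity; rewrite ?expr0 ?expr1 /=; field.
Qed.

Lemma scaled_stab_odd : scaled_stab R 6 (vec 6 (odd_sum C)).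
Proof.
have := scaled_stab_rotationN R 6 yz_string _ (scaled_stab_plus 6).
move=> /(scaled_stabZ R 6 2^-1); rewrite yz_string_plus tpow_ket; congr scaled_stab.
apply/matrixP => i j; rewrite !mxE big1_seq; last by move=> k _; case: ifP.
by rewrite /odd_sum; case: parity; rewrite ?expr0 ?expr1 /=; field.
Qed.

Lemma scaled_stab_triangle : scaled_stab R 6 (vec 6 (triangle C)).
Proof.
have /(scaled_stab_i_pow_weight 3) := scaled_stab_odd.
(* Three phase rotations about Z on qubits 0, 1, 2 produce the cubed factor of [triangle]. *)
do 3 move=> /(scaled_stab_phase 6 (ltn^~ 3)).
by congr scaled_stab; apply/matrixP => i j; rewrite !mxE /triangle !exprS expr0 !mulrA mulr1.
Qed.

Lemma psi_ket (psi : 'cV[C]_2) : psi = ket (psi 0 0) (psi 1 0).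
Proof.
by apply/matrixP => i j; rewrite [j]ord1 mxE; case: i => -[|[|//]] ? /=;
  congr (psi _ 0); apply/val_inj.
Qed.

Lemma stab_sum_tpow6 (psi : 'cV[C]_2) : stab_sum R 6 (tpow 6 psi) 8.
Proof.
rewrite (psi_ket psi); set x := psi 0 0; set y := psi 1 0.
have b0 : scaled_stab R 6 (vec 6 (basis0 C)).
  have := scaled_stab_ket_0 6; rewrite tpow_ket; congr scaled_stab.
  by apply/matrixP => i j; rewrite !mxE; apply: eq_bigr => k _; case: bit_fun.
have b1 : scaled_stab R 6 (vec 6 (basis1 C)).
  have := scaled_stab_ket_1 6; rewrite tpow_ket; congr scaled_stab.
  by apply/matrixP => i j; rewrite !mxE; apply: eq_bigr => k _; case: bit_fun.
pose d w : C := x ^+ (6 - w) * y ^+ w.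
(* The list follows the terms of [six_qubit_identity], the final minus sign moving into the
   coefficient. *)
exists [:: (d 0 - d 4) *: vec 6 (basis0 C); (d 6 - d 2) *: vec 6 (basis1 C);
  ((d 4 + d 2) / 2) *: vec 6 (even_sum C);
  ((d 4 - d 2) / 2) *: vec 6 (fun b => i_pow_weight C 6 b * even_sum C b);
  ((d 3 + (d 1 + d 5) / 2) / 2) *: vec 6 (odd_sum C);
  ('i * (d 3 - (d 1 + d 5) / 2) / 2) *: vec 6 (fun b => i_pow_weight C 6 b * odd_sum C b);
  ((d 1 - d 5) / 4) *: vec 6 (triangle C);
  (- ('i * (d 1 - d 5) / 4)) *: vec 6 (fun b => i_pow_weight C 6 b * triangle C b)].
split=> // [w|].
  have es := scaled_stab_even; have os := scaled_stab_odd; have ts := scaled_stab_triangle.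
  rewrite !inE => /or4P[| | |/or4P[| | |/orP[]]] => /eqP ->; apply: scaled_stabZ => //;
  exact: scaled_stab_i_pow_weight.
rewrite tpow_ket; apply/matrixP => i j; rewrite !big_cons big_nil addr0 !mxE.
by rewrite six_qubit_identity -/(d _) mulNr !addrA.
Qed.

Lemma stab_sum_tpow1 (psi : 'cV[C]_2) : stab_sum R 1 (tpow 1 psi) 2.
Proof.
exists [:: psi 0 0 *: tpow 1 (ket 1 0); psi 1 0 *: tpow 1 (ket 0 1)].
split=> // [w|].
  rewrite !inE => /orP[] /eqP->; apply: scaled_stabZ.
    exact: scaled_stab_ket_0.
  exact: scaled_stab_ket_1.
rewrite {1}(psi_ket psi) !big_cons big_nil addr0; apply/matrixP => i j.
rewrite !mxE !big_ord1 !mxE.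
by case: eqP => _; rewrite !(mulr0, mulr1, addr0, add0r).
Qed.

(** Each six-qubit block contributes a factor 8, and each leftover qubit a factor 2 from its
    expansion in |0> and |1>. *)
Lemma stab_sum_tpow (psi : 'cV[C]_2) a r :
  stab_sum R (6 * a + r) (tpow (6 * a + r) psi) (8 ^ a * 2 ^ r).
Proof.
elim: a => [|a IHa]; last first.
  rewrite mulnS expnS -addnA -mulnA tpow_kron.
  exact: stab_sum_kron (stab_sum_tpow6 psi) IHa.
rewrite muln0 add0n expn0 mul1n; elim: r => [|r IHr]; last first.
  by rewrite -add1n expnD tpow_kron; exact: stab_sum_kron (stab_sum_tpow1 psi) IHr.
exists [:: tpow 0 psi]; split=> // [w|]; last by rewrite big_seq1.
rewrite inE => /eqP->; have := scaled_stab_ket_0 0; congr scaled_stab.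
by apply/matrixP => i j; rewrite !mxE !big_ord0.
Qed.

End StabilizerVectors.

(** * The asymptotic bound *)

Theorem theorem3 (R : realType) (psi : 'cV[R[i]]_2) :
  `|psi 0 0| ^+ 2 + `|psi 1 0| ^+ 2 = 1 ->
  exists (K : R) (M : nat), forall m : nat, (M <= m)%N ->
    ((stab_rank (tpow m psi))%:R : R) <= K * (m.+1)%:R * Num.sqrt 2 ^+ m.
Proof.
(* At most five qubits remain outside the blocks, costing at most 2^5 = 32; the blocks cost a power
   of 8 = (sqrt 2)^6, at most (sqrt 2)^m. *)
move=> _; exists 32, 0%N => m _.
have rank_le := stab_rank_le _ _ _ _ (stab_sum_tpow R psi (m %/ 6) (m %% 6)).
have eqm : (6 * (m %/ 6) + m %% 6 = m)%N by rewrite mulnC -divn_eq.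
rewrite eqm in rank_le.
have sqrt2_ge1 : 1 <= Num.sqrt 2 :> R.
  by rewrite -{1}sqrtr1 ler_sqrt ?ler1n.
have sqrt2_6 : Num.sqrt 2 ^+ 6 = 8 :> R.
  by rewrite (exprM _ 2 3) sqr_sqrtr ?ler0n // -natrX.
have rem_le : 2 ^+ (m %% 6) <= 32 :> R.
  rewrite -natrX ler_nat (leq_trans (n := 2 ^ 5)) // leq_pexp2l //.
  by rewrite -ltnS ltn_mod.
apply: le_trans (_ : (8 ^ (m %/ 6) * 2 ^ (m %% 6))%:R <= _).
  by rewrite ler_nat.
rewrite natrM !natrX -sqrt2_6 -exprM.
apply: le_trans (_ : Num.sqrt 2 ^+ m * 32 <= _).
  apply: ler_pM => //; rewrite ?exprn_ge0 ?sqrtr_ge0 ?ler0n //.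
  by rewrite ler_weXn2l // -{2}eqm leq_addr.
(* The linear factor enters through 1 <= m + 1. *)
rewrite [32 * _]mulrC -mulrA [32 * _]mulrC ler_peMl ?ler1n //.
by rewrite mulr_ge0 ?exprn_ge0 ?sqrtr_ge0 ?ler0n.
Qed.
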